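(* Let $(C_n)_{n\ge1}$ be random variables such that (1) $1\le C_n\le B^n$ almost surely for every $n\ge1$, for a deterministic constant $B\ge1$, and (2) for every $n,\ell\ge1$, there exists a random variable $C_\ell'$ with the same law as $C_\ell$, independent of $C_n$, and satisfying $C_{n+\ell}\le C_nC_\ell'$ almost surely. Then for every $q\in\mathbb R$, the limit $\Lambda_C(q):=\lim_{n\to\infty} n^{-1}\log\mathbb E[C_n^q]$ exists. For $q\ge0$, one has $\Lambda_C(q)=\inf_{n\ge1} n^{-1}\log\mathbb E[C_n^q]$, while for $q<0$, one has $\Lambda_C(q)=\sup_{n\ge1} n^{-1}\log\mathbb E[C_n^q]$. Moreover, $\Lambda_C$ is finite and convex on $\mathbb R$, and $\min\{0,q\log B\}\le\Lambda_C(q)\le\max\{0,q\log B\}$ for all $q\in\mathbb R$. If $I_{C,+}(x):=\sup_{q\ge0}\{qx-\Lambda_C(q)\}$ and $I_{C,-}(x):=\sup_{q\le0}\{qx-\Lambda_C(q)\}$, then, for every $x\in\mathbb R$, $$\limsup_{n\to\infty} n^{-1}\log\mathbb P(Y_n\ge x)\le -I_{C,+}(x) \qquad\text{and}\qquad \limsup_{n\to\infty} n^{-1}\log\mathbb P(Y_n\le x)\le -I_{C,-}(x),$$ where $Y_n:=n^{-1}\log C_n$.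
   Context: The random variables are real-valued. The variable $C_\ell'$ in (2) may depend on $n$ as well as on $\ell$. Conventions: $\log 0=-\infty$; $I_{C,\pm}$ may take the value $+\infty$. *)

(* Defs.v *)
From mathcomp Require Import all_boot all_order all_algebra.
From mathcomp Require Import all_classical all_reals all_analysis.

Set Implicit Arguments.
Unset Strict Implicit.
Unset Printing Implicit Defensive.

Import Order.TTheory GRing.Theory Num.Theory.
Import numFieldNormedType.Exports.

Local Open Scope classical_set_scope.
Local Open Scope ring_scope.

Section Probability.
Context (d : measure_display) (T : measurableType d) (R : realType)
  (P : probability T R).

(* The quantifier is restricted to measurable sets because the value of a
   measure outside of the sigma-algebra is unspecified. *)
Definition same_law (X Y : {RV P >-> R}) : Prop :=
  forall A : set R, measurable A -> distribution P X A = distribution P Y A.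

Definition independent_RV (X Y : {RV P >-> R}) : Prop :=
  forall A B : set R, measurable A -> measurable B ->
    P (X @^-1` A `&` Y @^-1` B) = (P (X @^-1` A) * P (Y @^-1` B))%E.

Variable C : nat -> {RV P >-> R}.

(* The terms of index [n = 0] of the sequences below are irrelevant. *)

Definition scaled_log_moment (q : R) (n : nat) : \bar R :=
  ((n%:R^-1)%:E * lne ('E_P[fun w => (C n w `^ q)%R]))%E.

Definition Lambda (q : R) : \bar R := limn (scaled_log_moment q).

Definition I_plus (x : R) : \bar R :=
  ereal_sup [set ((q * x)%:E - Lambda q)%E | q in [set q : R | 0 <= q]].

Definition I_minus (x : R) : \bar R :=
  ereal_sup [set ((q * x)%:E - Lambda q)%E | q in [set q : R | q <= 0]].

Definition scaled_log (n : nat) (w : T) : R := n%:R^-1 * ln (C n w).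

End Probability.

(* Main.v *)
(* By submultiplicativity and independence, [log E[C_n^q]] is subadditive in [n]
   for [q >= 0] and superadditive for [q <= 0]; since it lies between the
   endpoints [0] and [n q log B], Fekete's lemma gives a finite limit, equal to
   the infimum (resp. supremum) of the averages.  Convexity passes to the limit
   from Hoelder's inequality at each [n].  The tail bounds are Chernoff's: for
   each admissible [q], [P(Y_n in tail) <= exp(- n q x) E[C_n^q]], and one takes
   the best [q] after the limit in [n]. *)
Require Import Defs.
From mathcomp Require Import all_boot all_order all_algebra.
From mathcomp Require Import all_classical all_reals all_analysis.
From mathcomp Require Import measurable_realfun ring lra.

Set Implicit Arguments.
Unset Strict Implicit.
Unset Printing Implicit Defensive.

Import Order.TTheory GRing.Theory Num.Theory.
Import numFieldNormedType.Exports.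

Local Open Scope classical_set_scope.
Local Open Scope ring_scope.

(** * Fekete's lemma for real sequences indexed from [1] *)

(** Split off the [k] blocks of length [m] one at a time. Subadditivity is known only at positive
    indices, so [u 0] may be negative; the absolute value keeps the bound true when [r = 0]. *)
Lemma subadditive_euclid (R : realDomainType) (u : nat -> R) (m k r : nat) :
  (forall n l : nat, (1 <= n)%N -> (1 <= l)%N -> u (n + l)%N <= u n + u l) ->
  (1 <= m)%N -> (1 <= k * m + r)%N ->
  u (k * m + r)%N <= k%:R * u m + `|u r|.
Proof.
move=> uS m1; elim: k => [|k IH] kr1.
  by rewrite mul0n add0n mul0r add0r ler_norm.
have [/eqP|kr0] := posnP (k * m + r).
  rewrite addn_eq0 muln_eq0 -[m == 0%N]leqn0 leqNgt m1 orbF => /andP[/eqP -> /eqP ->].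
  by rewrite mul1n addn0 mul1r lerDl.
rewrite mulSn -addnA (le_trans (uS _ _ m1 kr0))//.
by rewrite -natr1 mulrDl mul1r addrAC [leRHS]addrC lerD2l IH.
Qed.

(** Choose [m] whose average is within [e / 2] of the infimum and divide [n] by [m]: the remainder
    costs at most a constant [D] independent of [n], and [D / n] tends to [0]. The lower bound [c]
    makes the infimum a genuine one. *)
Lemma fekete (R : realType) (u : nat -> R) (c : R) :
  (forall n l : nat, (1 <= n)%N -> (1 <= l)%N -> u (n + l)%N <= u n + u l) ->
  (forall n : nat, (1 <= n)%N -> c <= n%:R^-1 * u n) ->
  n%:R^-1 * u n @[n --> \oo] -->
    inf [set n%:R^-1 * u n | n in [set n : nat | (1 <= n)%N]].
Proof.
move=> uS cu; set S := [set _ | _ in _]; set L := inf S.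
have infS : has_inf S.
  by split; [exists (1^-1 * u 1%N), 1%N|exists c => _ [n /= n1 <-]; exact: cu].
have LS n : (1 <= n)%N -> L <= n%:R^-1 * u n.
  by move=> n1; apply: ge_inf; [exact: infS.2|exists n].
apply/cvgrPdist_le => /= e e0.
have [_ [m /= m1 <-] mL] := inf_adherent (divr_gt0 e0 (ltr0Sn _ 1)) infS.
(* The sum dominates [u (n %% m)] for every remainder; [|u m|] pays for replacing the quotient
   [n %/ m] by the real number [n / m], an error of less than one copy of [u m]. *)
pose D := `|u m| + \sum_(r < m) `|u r|.
near=> n.
have n0 : (0 < n)%N by near: n; exact: nbhs_infty_gt.
(* The lower estimate is immediate because [L] is a lower bound of the averages; only the upper one
   needs work. *)
rewrite ler_distlC (le_trans _ (LS _ n0)) ?lerBlDr ?lerDl ?(ltW e0)//=.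
have nR : 0 < n%:R :> R by rewrite ltr0n.
have mR : 0 < m%:R :> R by rewrite ltr0n.
have un : u n <= n%:R * (m%:R^-1 * u m) + D.
  have rm : (n %% m < m)%N by rewrite ltn_mod.
  have := @subadditive_euclid R u m (n %/ m) (n %% m) uS m1.
  rewrite -divn_eq => /(_ n0) /le_trans; apply.
  have -> : (n%:R : R) = (n %/ m)%:R * m%:R + (n %% m)%:R.
    by rewrite -natrM -natrD -divn_eq.
  rewrite mulrDl -mulrA mulVKf ?gt_eqF// -addrA lerD2l /D addrA.
  rewrite -[leLHS]add0r; apply: lerD; last first.
    rewrite (bigD1 (Ordinal rm))//= lerDl; exact: sumr_ge0.
  rewrite -lerBlDl sub0r (le_trans (ler_norm _))// normrN mulrA normrM ler_piMl//.
  by rewrite normrM normfV !ger0_norm ?ler0n// ler_pdivrMr// mul1r ler_nat ltnW.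
have Dn : D / n%:R <= e / 2%:R.
  rewrite ler_pdivrMr// mulrC -ler_pdivrMr ?divr_gt0//.
  by near: n; exact: nbhs_infty_ger.
rewrite (@le_trans _ _ (n%:R^-1 * (n%:R * (m%:R^-1 * u m) + D)))//.
  by rewrite ler_pM2l ?invr_gt0.
rewrite mulrDr mulKf ?gt_eqF// [_ * D]mulrC.
move: mL Dn; lra.
Unshelve. all: by end_near. Qed.

(** Apply [fekete] to [- u]: [inf] unfolds to the opposite of the [sup] of the negated set, and the
    signs cancel. *)
Lemma superadditive_fekete (R : realType) (u : nat -> R) (c : R) :
  (forall n l : nat, (1 <= n)%N -> (1 <= l)%N -> u n + u l <= u (n + l)%N) ->
  (forall n : nat, (1 <= n)%N -> n%:R^-1 * u n <= c) ->
  n%:R^-1 * u n @[n --> \oo] -->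
    sup [set n%:R^-1 * u n | n in [set n : nat | (1 <= n)%N]].
Proof.
move=> uS uc; set S := [set _ | _ in _].
have := @fekete R (\- u) (- c).
have -> : [set n%:R^-1 * (\- u) n | n in [set n : nat | (1 <= n)%N]] = -%R @` S.
  by rewrite image_comp; apply: eq_imagel => n _; exact: mulrN.
have -> : (fun n => n%:R^-1 * u n) = - (fun n => n%:R^-1 * (\- u) n).
  by apply/funext => n; rewrite !fctE mulrN opprK.
rewrite /inf setNK => /(_ _ _)/cvgN; rewrite opprK.
apply=> [n l n1 l1|n n1] /=; first by rewrite -opprD lerN2 uS.
by rewrite mulrN lerN2 uc.
Qed.

(** * Expectations of nonnegative functions and of powers *)

Section nonnegative_expectation.
Context (d : measure_display) (T : measurableType d) (R : realType)
  (P : probability T R).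

(** Independence says that the law of the pair agrees with the product of the laws on measurable
    rectangles, hence everywhere by uniqueness of the product measure; Tonelli then separates the
    integrals. *)
Lemma integral_independentM (d1 d2 : measure_display)
    (T1 : measurableType d1) (T2 : measurableType d2)
    (X : {mfun T >-> T1}) (Y : {mfun T >-> T2})
    (f : T1 -> \bar R) (g : T2 -> \bar R) :
  (forall A B, measurable A -> measurable B ->
    P (X @^-1` A `&` Y @^-1` B) = (P (X @^-1` A) * P (Y @^-1` B))%E) ->
  measurable_fun [set: T1] f -> measurable_fun [set: T2] g ->
  (forall x, 0 <= f x)%E -> (forall y, 0 <= g y)%E ->
  (\int[P]_w (f (X w) * g (Y w)) = \int[P]_w f (X w) * \int[P]_w g (Y w))%E.
Proof.
move=> XY mf mg f0 g0.
have mXY : measurable_fun [set: T] (fun w => (X w, Y w)).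
  exact: measurable_fun_pair.
pose Z : {mfun T >-> (T1 * T2)%type} := mfun_Sub (mem_set mXY).
pose h (z : T1 * T2) := (f z.1 * g z.2)%E.
have mh : measurable_fun [set: T1 * T2] h.
  by apply: emeasurable_funM; exact: measurableT_comp.
have h0 z : (0 <= h z)%E by rewrite mule_ge0.
transitivity (\int[distribution P Z]_z h z)%E.
  by rewrite ge0_integral_distribution.
rewrite (eq_measure_integral (distribution P X \x distribution P Y)%E); last first.
  move=> A mA _; apply/esym.
  by apply: product_measure_unique => // D E mD mE; rewrite -XY.
rewrite fubini_tonelli1//.
transitivity (\int[distribution P X]_x
    (f x * \int[distribution P Y]_y g y))%E.
  by apply: eq_integral => x _; rewrite /fubini_F/h/= ge0_integralZl.
rewrite ge0_integralZr//; last by apply: integral_ge0 => y _.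
by rewrite !ge0_integral_distribution.
Qed.

Lemma expectation_independentM (X Y : {RV P >-> R}) (f g : R -> R) :
  independent_RV X Y ->
  measurable_fun [set: R] f -> measurable_fun [set: R] g ->
  (forall x, 0 <= f x) -> (forall x, 0 <= g x) ->
  ('E_P[fun w => (f (X w) * g (Y w))%R] =
   'E_P[fun w => f (X w)] * 'E_P[fun w => g (Y w)])%E.
Proof.
move=> XY mf mg f0 g0; rewrite unlock.
under eq_integral do rewrite EFinM.
by apply: (@integral_independentM _ _ _ _ X Y (EFin \o f) (EFin \o g)) => //;
  exact/measurable_EFinP.
Qed.

Lemma expectation_same_law (X Y : {RV P >-> R}) (f : R -> R) :
  same_law X Y -> measurable_fun [set: R] f -> (forall x, 0 <= f x) ->
  ('E_P[fun w => f (X w)] = 'E_P[fun w => f (Y w)])%E.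
Proof.
move=> XY mf f0; have mEf : measurable_fun [set: R] (EFin \o f).
  exact/measurable_EFinP.
rewrite unlock.
rewrite -[LHS](@ge0_integral_distribution _ _ _ _ _ P X (EFin \o f))//.
rewrite -[RHS](@ge0_integral_distribution _ _ _ _ _ P Y (EFin \o f))//.
by apply: eq_measure_integral => A mA _; exact: XY.
Qed.

Lemma measurable_powR_RV (X : {RV P >-> R}) (q : R) :
  measurable_fun [set: T] (fun w => X w `^ q).
Proof. by apply: (measurableT_comp (measurable_powR q)). Qed.

Lemma chernoff_powR (X : {RV P >-> R}) (A : set T) (q k : R) :
  measurable A -> {ae P, forall w, 0 < X w} ->
  (forall w, A w -> k <= q * ln (X w)) ->
  ((expR k)%:E * P A <= 'E_P[fun w => (X w `^ q)%R])%E.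
Proof.
move=> mA X0 Ak.
rewrite unlock -[X in P X]setIT -integral_indic// -ge0_integralZl//; last exact/measurable_EFinP.
apply: ae_ge0_le_integral; first by [].
- by move=> w _; rewrite -EFinM lee_fin mulr_ge0 ?expR_ge0.
- by under eq_fun do rewrite -EFinM; apply/measurable_EFinP/measurable_funM.
- by move=> w _; rewrite lee_fin powR_ge0.
- exact/measurable_EFinP/measurable_powR_RV.
- apply: filterS X0 => w X0 _; rewrite -EFinM lee_fin indicE.
  case: (boolP (w \in A)) => [/set_mem /Ak kX|_]; last by rewrite mulr0 powR_ge0.
  by rewrite mulr1 /powR gt_eqF// ler_expR.
Qed.

(* Hoelder's inequality: integrate the convexity inequality of [expR] for the
   powers of [X] normalised by [expR a] and [expR b]. *)
Lemma expectation_powR_log_convex (X : {RV P >-> R}) (q r a b : R)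
    (t : {i01 R}) :
  {ae P, forall w, 0 < X w} ->
  ('E_P[fun w => (X w `^ q)%R] = (expR a)%:E)%E ->
  ('E_P[fun w => (X w `^ r)%R] = (expR b)%:E)%E ->
  ('E_P[fun w => (X w `^ (t%:num * q + (1 - t%:num) * r))%R] <=
   (expR (t%:num * a + (1 - t%:num) * b))%:E)%E.
Proof.
move=> X0 Eq Er.
have s0 : 0 <= t%:num by [].
have s1 : 0 <= 1 - t%:num by rewrite subr_ge0.
move: s0 s1; set s := t%:num => s0 s1; set c := s * a + _.
pose f (w : T) := s * expR (- a) * X w `^ q.
pose g (w : T) := (1 - s) * expR (- b) * X w `^ r.
have f0 w : 0 <= f w by rewrite !mulr_ge0 ?expR_ge0 ?powR_ge0.
have g0 w : 0 <= g w by rewrite !mulr_ge0 ?expR_ge0 ?powR_ge0.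
have mf : measurable_fun [set: T] f.
  by apply: measurable_funM => //; exact: measurable_powR_RV.
have mg : measurable_fun [set: T] g.
  by apply: measurable_funM => //; exact: measurable_powR_RV.
(* Each normalised power has integral [1], so [f + g] has integral [s + (1 - s) = 1]. *)
have -> : (expR c)%:E = (\int[P]_w (expR c * (f w + g w))%:E)%E.
  under eq_integral do rewrite EFinM EFinD.
  rewrite ge0_integralZl//; last 2 first.
  - by apply: emeasurable_funD; exact/measurable_EFinP.
  - by move=> w _; rewrite adde_ge0 ?lee_fin.
  rewrite ge0_integralD//; last 4 first.
  - by move=> w _; rewrite lee_fin.
  - exact/measurable_EFinP.
  - by move=> w _; rewrite lee_fin.
  - exact/measurable_EFinP.
  rewrite /f /g.
  under eq_integral do rewrite EFinM.
  under [X in (_ + X)%E]eq_integral do rewrite EFinM.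
  rewrite !ge0_integralZl//; last 6 first.
  - exact/measurable_EFinP/measurable_powR_RV.
  - by move=> w _; rewrite lee_fin powR_ge0.
  - by rewrite lee_fin mulr_ge0 ?expR_ge0.
  - exact/measurable_EFinP/measurable_powR_RV.
  - by move=> w _; rewrite lee_fin powR_ge0.
  - by rewrite lee_fin mulr_ge0 ?expR_ge0.
  move: Eq Er; rewrite unlock => -> ->.
  congr EFin; rewrite -!mulrA -!expRD !addNr expR0 !mulr1.
  by rewrite addrC subrK mulr1.
rewrite unlock; apply: ae_ge0_le_integral; first by [].
- by move=> w _; rewrite lee_fin powR_ge0.
- exact/measurable_EFinP/measurable_powR_RV.
- by move=> w _; rewrite lee_fin mulr_ge0 ?expR_ge0 ?addr_ge0.
- by apply/measurable_EFinP; apply: measurable_funM => //; exact: measurable_funD.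
- apply: filterS X0 => w X0 _; rewrite lee_fin /f /g /powR gt_eqF//.
  rewrite -ler_pdivrMl ?expR_gt0// -expRN -expRD.
  have := convex_expR t (- a + q * ln (X w)) (- b + r * ln (X w)).
  rewrite !convRE /= -!mulrA -!expRD; apply: le_trans.
  by rewrite ler_expR /c -/s /unstable.onem le_eqVlt; apply/orP; left; apply/eqP; ring.
Qed.

(** Almost surely [q * ln (X w)] lies between [0] and [q * ln b], in an order that depends on the
    sign of [q]; the minimum and maximum absorb this. *)
Lemma expectation_powR_bounds (X : {RV P >-> R}) (b q : R) :
  {ae P, forall w, 1 <= X w <= b} ->
  ((expR (Num.min 0 (q * ln b)))%:E <= 'E_P[fun w => (X w `^ q)%R]
    <= (expR (Num.max 0 (q * ln b)))%:E)%E.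
Proof.
move=> Xb; rewrite -!(expectation_cst P).
have Xq : {ae P, forall w, expR (Num.min 0 (q * ln b)) <= X w `^ q <=
                           expR (Num.max 0 (q * ln b))}.
  apply: filterS Xb => w /andP[X1 Xb].
  have X0 : 0 < X w by rewrite (lt_le_trans _ X1).
  have lX0 : 0 <= ln (X w) by rewrite ln_ge0.
  have lXb : ln (X w) <= ln b by rewrite ler_ln ?posrE// (lt_le_trans X0).
  rewrite /powR gt_eqF// !ler_expR.
  have [q0|/ltW q0] := leP 0 q.
    have qX : 0 <= q * ln (X w) by rewrite mulr_ge0.
    have qb : q * ln (X w) <= q * ln b by rewrite ler_wpM2l.
    by rewrite ge_min le_max qX qb orbT.
  have qX : q * ln (X w) <= 0 by rewrite mulr_le0_ge0.
  have qb : q * ln b <= q * ln (X w) by rewrite ler_wnM2l.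
  by rewrite ge_min le_max qX qb orbT.
apply/andP; split; apply: expectation_le => //.
- exact: measurable_powR_RV.
- by move=> w; exact: expR_ge0.
- by move=> w; exact: powR_ge0.
- by apply: filterS Xq => w /andP[].
- exact: measurable_powR_RV.
- by move=> w; exact: powR_ge0.
- by move=> w; exact: expR_ge0.
- by apply: filterS Xq => w /andP[].
Qed.

End nonnegative_expectation.

(** The suprema over the tails compare from rank [N] on. An eventual hypothesis is enough, which
    allows index [0] to be ignored. *)
Lemma le_limn_esup (R : realType) (u v : (\bar R)^nat) :
  (\forall n \near \oo, (u n <= v n)%E) -> (limn_esup u <= limn_esup v)%E.
Proof.
move=> [N _ uv]; rewrite !limn_esup_lim.
apply: lee_lim; [exact: is_cvg_esups|exact: is_cvg_esups|].
exists N => // n /= Nn; apply: ge_ereal_sup => _ [k /= nk <-].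
apply: le_ereal_sup_tmp; exists (v k); first by exists k.
by apply: uv => /=; rewrite (leq_trans Nn).
Qed.

(** * Logarithmic moments: bounds, subadditivity and superadditivity *)

Section submultiplicative_sequence.
Context (d : measure_display) (T : measurableType d) (R : realType)
  (P : probability T R) (C : nat -> {RV P >-> R}) (B : R).
Hypothesis B_ge1 : 1 <= B.
Hypothesis C_bounded : forall n : nat, (1 <= n)%N ->
  {ae P, forall w : T, 1 <= C n w <= B ^+ n}.
Hypothesis C_submult : forall n l : nat, (1 <= n)%N -> (1 <= l)%N ->
  exists C' : {RV P >-> R},
    [/\ same_law C' (C l), independent_RV C' (C n) &
        {ae P, forall w : T, C (n + l)%N w <= C n w * C' w}].

(** A real-valued logarithmic moment, to which Fekete's lemma applies. For [n >= 1] the expectation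
    is positive and finite, so [fine] loses nothing. *)
Let M (q : R) (n : nat) : R := fine (lne 'E_P[fun w => (C n w `^ q)%R]).

Lemma ae_gt0 n : (1 <= n)%N -> {ae P, forall w, 0 < C n w}.
Proof.
move=> n1; apply: filterS (C_bounded n1) => w /andP[C1 _].
exact: lt_le_trans C1.
Qed.

Lemma expectation_powR_expR q n : (1 <= n)%N ->
  ('E_P[fun w => (C n w `^ q)%R] = (expR (M q n))%:E)%E.
Proof.
move=> n1; have := expectation_powR_bounds q (C_bounded n1); rewrite /M.
case: ('E_P[_])%E => [e| |] /andP[]; last 2 first.
- by rewrite leye_eq.
- by rewrite leeNy_eq.
rewrite !lee_fin => e0 _; have {}e0 := lt_le_trans (expR_gt0 _) e0.
by rewrite lne_EFin//= lnK.
Qed.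

Lemma scaled_log_momentE q n : (1 <= n)%N ->
  scaled_log_moment C q n = (n%:R^-1 * M q n)%:E.
Proof.
move=> n1; rewrite /scaled_log_moment expectation_powR_expR//.
by rewrite lne_EFin ?expR_gt0// expRK EFinM.
Qed.

Lemma scaled_log_moment_bounds q n : (1 <= n)%N ->
  Num.min 0 (q * ln B) <= n%:R^-1 * M q n <= Num.max 0 (q * ln B).
Proof.
move=> n1; have n0 : 0 < n%:R :> R by rewrite ltr0n.
have := expectation_powR_bounds q (C_bounded n1).
rewrite expectation_powR_expR// !lee_fin !ler_expR.
rewrite lnXn ?(lt_le_trans _ B_ge1)// -[ln B *+ n]mulr_natl mulrCA.
(* Writing [0] as [n%:R * 0] lets the factor [n] come out of the minimum and the maximum. *)
rewrite -[X in Num.min X _](mulr0 n%:R) -[X in Num.max X _](mulr0 n%:R).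
by rewrite -minr_pMr ?ler0n// -maxr_pMr ?ler0n// ler_pdivlMl// ler_pdivrMl.
Qed.

(* In both lemmas below, [1 <= C (n + l) <= C n * C'] forces [0 < C'], so that
   the power of the product is the product of the powers. *)
Lemma log_moment_subadditive q n l : 0 <= q -> (1 <= n)%N -> (1 <= l)%N ->
  M q (n + l)%N <= M q n + M q l.
Proof.
move=> q0 n1 l1; have [C' [C'l C'n CC']] := C_submult n1 l1.
have nl1 : (1 <= n + l)%N by rewrite addn_gt0 n1.
suff : ('E_P[fun w => (C (n + l)%N w `^ q)%R] <=
         'E_P[fun w => (C l w `^ q)%R] * 'E_P[fun w => (C n w `^ q)%R])%E.
  by rewrite !expectation_powR_expR// -EFinM -expRD lee_fin ler_expR [leRHS]addrC.
(* Replacing [C l] by its copy [C'], independent of [C n], turns the product of expectations into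
   the expectation of a product. *)
rewrite -(expectation_same_law C'l (measurable_powR q) (@powR_ge0 R ^~ q)).
rewrite -(expectation_independentM C'n (measurable_powR q) (measurable_powR q)
  (@powR_ge0 R ^~ q) (@powR_ge0 R ^~ q)).
apply: expectation_le.
- exact: measurable_powR_RV.
- by apply: measurable_funM; exact: measurable_powR_RV.
- by move=> w; exact: powR_ge0.
- by move=> w; rewrite mulr_ge0 ?powR_ge0.
- apply: filterS3 (ae_gt0 nl1) (ae_gt0 n1) CC' => w Cnl0 Cn0 CC'.
  have C'0 : 0 < C' w by rewrite -(pmulr_rgt0 _ Cn0) (lt_le_trans Cnl0).
  rewrite mulrC -powRM ?(ltW Cn0) ?(ltW C'0)//.
  by rewrite ge0_ler_powR// nnegrE ?mulr_ge0 ?ltW.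
Qed.

Lemma log_moment_superadditive q n l : q <= 0 -> (1 <= n)%N -> (1 <= l)%N ->
  M q n + M q l <= M q (n + l)%N.
Proof.
move=> q0 n1 l1; have [C' [C'l C'n CC']] := C_submult n1 l1.
have nl1 : (1 <= n + l)%N by rewrite addn_gt0 n1.
suff : ('E_P[fun w => (C l w `^ q)%R] * 'E_P[fun w => (C n w `^ q)%R] <=
         'E_P[fun w => (C (n + l)%N w `^ q)%R])%E.
  by rewrite !expectation_powR_expR// -EFinM -expRD lee_fin ler_expR [leLHS]addrC.
rewrite -(expectation_same_law C'l (measurable_powR q) (@powR_ge0 R ^~ q)).
rewrite -(expectation_independentM C'n (measurable_powR q) (measurable_powR q)
  (@powR_ge0 R ^~ q) (@powR_ge0 R ^~ q)).
apply: expectation_le.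
- by apply: measurable_funM; exact: measurable_powR_RV.
- exact: measurable_powR_RV.
- by move=> w; rewrite mulr_ge0 ?powR_ge0.
- by move=> w; exact: powR_ge0.
- apply: filterS3 (ae_gt0 nl1) (ae_gt0 n1) CC' => w Cnl0 Cn0 CC'.
  have C'0 : 0 < C' w by rewrite -(pmulr_rgt0 _ Cn0) (lt_le_trans Cnl0).
  rewrite mulrC -powRM ?(ltW Cn0) ?(ltW C'0)//.
  (* For [q <= 0] the power reverses the order, as seen on the exponents [q * ln _]. *)
  rewrite /powR !gt_eqF ?mulr_gt0// ler_expR ler_wnM2l//.
  by rewrite ler_ln ?posrE ?mulr_gt0.
Qed.

(** * Existence, bounds and convexity of the limit *)

Lemma image_scaled_log_moment q :
  [set scaled_log_moment C q n | n in [set n : nat | (1 <= n)%N]] =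
  EFin @` [set n%:R^-1 * M q n | n in [set n : nat | (1 <= n)%N]].
Proof.
rewrite image_comp; apply: eq_imagel => n /= n1.
by rewrite scaled_log_momentE.
Qed.

Lemma cvg_scaled_log_moment q (l : R) :
  n%:R^-1 * M q n @[n --> \oo] --> l ->
  scaled_log_moment C q @ \oo --> l%:E.
Proof.
move=> Ml; apply: (@cvg_trans _ ((n%:R^-1 * M q n)%:E @[n --> \oo])).
  apply: near_eq_cvg; exists 1%N => // n /= n1.
  by rewrite scaled_log_momentE.
by apply: cvg_EFin; [exact: nearW|].
Qed.

(** The averages form a nonempty set bounded below, so the extended infimum is the real one produced
    by [fekete]. *)
Lemma scaled_log_moment_cvg_inf q : 0 <= q ->
  scaled_log_moment C q @ \oo --> ereal_inf
    [set scaled_log_moment C q n | n in [set n : nat | (1 <= n)%N]].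
Proof.
move=> q0; rewrite image_scaled_log_moment ereal_inf_EFin.
- apply: cvg_scaled_log_moment.
  apply: (fekete (c := Num.min 0 (q * ln B))) => [n l|n n1].
    exact: log_moment_subadditive.
  by have /andP[] := scaled_log_moment_bounds q n1.
- exists (Num.min 0 (q * ln B)) => _ [n /= n1 <-].
  by have /andP[] := scaled_log_moment_bounds q n1.
- by exists (1^-1 * M q 1), 1%N.
Qed.

Lemma scaled_log_moment_cvg_sup q : q <= 0 ->
  scaled_log_moment C q @ \oo --> ereal_sup
    [set scaled_log_moment C q n | n in [set n : nat | (1 <= n)%N]].
Proof.
move=> q0; rewrite image_scaled_log_moment ereal_sup_EFin.
- apply: cvg_scaled_log_moment.
  apply: (superadditive_fekete (c := Num.max 0 (q * ln B))) => [n l|n n1].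
    exact: log_moment_superadditive.
  by have /andP[] := scaled_log_moment_bounds q n1.
- exists (Num.max 0 (q * ln B)) => _ [n /= n1 <-].
  by have /andP[] := scaled_log_moment_bounds q n1.
- by exists (1^-1 * M q 1), 1%N.
Qed.

Lemma is_cvg_scaled_log_moment q : cvgn (scaled_log_moment C q).
Proof.
by apply/cvg_ex; have [q0|/ltW q0] := leP 0 q; eexists;
  [exact: scaled_log_moment_cvg_inf|exact: scaled_log_moment_cvg_sup].
Qed.

Lemma Lambda_bounds q :
  ((Num.min 0 (q * ln B))%:E <= Lambda C q <= (Num.max 0 (q * ln B))%:E)%E.
Proof.
apply/andP; split; [apply: lime_ge|apply: lime_le];
  try exact: is_cvg_scaled_log_moment;
  by exists 1%N => // n /= n1; rewrite scaled_log_momentE// lee_fin;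
     have /andP[] := scaled_log_moment_bounds q n1.
Qed.

Lemma Lambda_fin_num q : Lambda C q \is a fin_num.
Proof.
have /andP[mL LM] := Lambda_bounds q.
by rewrite fin_numElt (lt_le_trans _ mL) ?ltNyr//= (le_lt_trans LM) ?ltry.
Qed.

(** Real-valued form of the convergence, so that sums and scalar multiples pass to the limit in the
    convexity proof. *)
Lemma cvg_log_moment q : n%:R^-1 * M q n @[n --> \oo] --> fine (Lambda C q).
Proof.
have : scaled_log_moment C q @ \oo --> Lambda C q.
  exact: is_cvg_scaled_log_moment.
rewrite -[Lambda C q]fineK ?Lambda_fin_num// => /fine_cvg.
apply: cvg_trans; apply: near_eq_cvg; exists 1%N => // n /= n1.
by rewrite scaled_log_momentE.
Qed.

Lemma Lambda_convex :
  convex_function [set: R^o] (fun q : R^o => fine (Lambda C q)).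
Proof.
move=> t q r _ _; rewrite convRE.
(* Both convex combinations are displayed with weights [t%:num] and [1 - t%:num], the form of
   [expectation_powR_log_convex]. *)
change (fine (Lambda C (t%:num * q + (1 - t%:num) * r)) <=
        t%:num * fine (Lambda C q) + (1 - t%:num) * fine (Lambda C r)).
apply: (@ler_cvg_to _ _ _ _ _ _ _ _ (@cvg_log_moment _)).
  by apply: cvgD; apply: cvgMr; exact: cvg_log_moment.
exists 1%N => // n /= n1.
rewrite fctE (mulrCA t%:num) (mulrCA (1 - t%:num)) -mulrDr ler_wpM2l ?invr_ge0 ?ler0n//.
rewrite -ler_expR -lee_fin -expectation_powR_expR//.
by apply: expectation_powR_log_convex; [exact: ae_gt0|
  exact: expectation_powR_expR|exact: expectation_powR_expR].
Qed.

(** * Exponential tail bounds *)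

Lemma measurable_scaled_log n : measurable_fun [set: T] (scaled_log C n).
Proof.
apply: measurable_funM => //.
by apply: (measurableT_comp (@measurable_ln R)).
Qed.

(** One statement for both tails: [q * x <= q * scaled_log C n w] holds on the upper tail when
    [q >= 0] and on the lower tail when [q <= 0]. The bound is [chernoff_powR] with [k = n q x]. *)
Lemma limn_esup_log_probability (A : nat -> set T) (q x : R) :
  (forall n, measurable (A n)) ->
  (forall n w, (1 <= n)%N -> A n w -> q * x <= q * scaled_log C n w) ->
  (limn_esup (fun n => (n%:R^-1)%:E * lne (P (A n))) <=
   Lambda C q - (q * x)%:E)%E.
Proof.
move=> mA Ax.
(* The right-hand side is a limit, hence a limit superior, and a comparison term by term for
   [n >= 1] suffices. *)
have <- : limn_esup (fun n => scaled_log_moment C q n - (q * x)%:E)%E =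
    (Lambda C q - (q * x)%:E)%E.
  apply: (cvg_limn_einf_sup _).2; apply: cvgeD.
  - by rewrite fin_num_adde_defl.
  - exact: is_cvg_scaled_log_moment.
  - exact: cvg_cst.
apply: le_limn_esup; exists 1%N => // n /= n1.
have n0 : 0 < n%:R :> R by rewrite ltr0n.
have := @chernoff_powR _ _ _ P (C n) (A n) q (n%:R * (q * x)) (mA n) (ae_gt0 n1).
rewrite expectation_powR_expR// scaled_log_momentE//.
have -> : P (A n) = (fine (P (A n)))%:E by rewrite fineK// fin_num_measure.
set p := fine _; rewrite -EFinM lee_fin => cher.
have {}cher : expR (n%:R * (q * x)) * p <= expR (M q n).
  apply: cher => w Anw; rewrite mulrC -ler_pdivlMr//.
  by have := Ax n w n1 Anw; rewrite /scaled_log mulrCA [n%:R^-1 * _]mulrC.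
(* On a null event [lne] is [-oo] and the bound is trivial; otherwise real logarithms apply. *)
have [p0|p0] := leP p 0.
  by rewrite le0_lneNy// gt0_muleNy ?leNye// lte_fin invr_gt0.
rewrite lne_EFin// -EFinM -EFinD lee_fin ler_pdivrMl// mulrDr mulrN.
rewrite mulVKf ?gt_eqF// lerBrDl -ler_expR expRD lnK//.
Qed.

End submultiplicative_sequence.

Theorem proposition3p3 (d : measure_display) (T : measurableType d)
    (R : realType) (P : probability T R) (C : nat -> {RV P >-> R}) (B : R)
    (B_ge1 : 1 <= B)
    (C_bounded : forall n : nat, (1 <= n)%N ->
      {ae P, forall w : T, 1 <= C n w <= B ^+ n})
    (C_submult : forall n l : nat, (1 <= n)%N -> (1 <= l)%N ->
      exists C' : {RV P >-> R},
        [/\ same_law C' (C l), independent_RV C' (C n) &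
            {ae P, forall w : T, C (n + l)%N w <= C n w * C' w}]) :
  [/\ forall q : R, cvgn (scaled_log_moment C q),
      forall q : R, 0 <= q ->
        Lambda C q = ereal_inf
          [set scaled_log_moment C q n | n in [set n : nat | (1 <= n)%N]],
      forall q : R, q < 0 ->
        Lambda C q = ereal_sup
          [set scaled_log_moment C q n | n in [set n : nat | (1 <= n)%N]] &
      [/\ forall q : R, Lambda C q \is a fin_num,
          convex_function [set: R^o] (fun q : R^o => fine (Lambda C q)),
          forall q : R, ((Num.min 0 (q * ln B))%:E <= Lambda C q
                          <= (Num.max 0 (q * ln B))%:E)%E,
          forall x : R,
            (limn_esup (fun n : nat =>
               (n%:R^-1)%:E * lne (P [set w | (x <= scaled_log C n w)%R]))
             <= - I_plus C x)%E &
          forall x : R,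
            (limn_esup (fun n : nat =>
               (n%:R^-1)%:E * lne (P [set w | (scaled_log C n w <= x)%R]))
             <= - I_minus C x)%E]].
Proof.
split=> [q|q q0|q /ltW q0|].
- exact: is_cvg_scaled_log_moment B_ge1 C_bounded C_submult q.
- by apply/cvg_lim => //;
    exact: scaled_log_moment_cvg_inf B_ge1 C_bounded C_submult q q0.
- by apply/cvg_lim => //;
    exact: scaled_log_moment_cvg_sup B_ge1 C_bounded C_submult q q0.
- split=> [q||q|x|x].
  + exact: Lambda_fin_num B_ge1 C_bounded C_submult q.
  + exact: Lambda_convex B_ge1 C_bounded C_submult.
  + exact: Lambda_bounds B_ge1 C_bounded C_submult q.
  (* Negating moves the supremum to the left, where it is bounded at each [q]; negating back leaves
     the upper bound [Lambda C q - q * x]. *)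
  + rewrite leeNr; apply: ge_ereal_sup => _ [q /= q0 <-].
    rewrite leeNr oppeB ?fin_num_adde_defr// addeC.
    apply: (limn_esup_log_probability B_ge1 C_bounded C_submult) => // [n|n w _ /= xY].
      rewrite -[X in measurable X]setTI.
      by apply: measurable_fun_le => //; exact: measurable_scaled_log.
    by rewrite ler_wpM2l.
  + rewrite leeNr; apply: ge_ereal_sup => _ [q /= q0 <-].
    rewrite leeNr oppeB ?fin_num_adde_defr// addeC.
    apply: (limn_esup_log_probability B_ge1 C_bounded C_submult) => // [n|n w _ /= xY].
      rewrite -[X in measurable X]setTI.
      by apply: measurable_fun_le => //; exact: measurable_scaled_log.
    by rewrite ler_wnM2l.
Qed.
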